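(* Let $n,r\ge1$ be integers, and let $\psi:G(n,r)\to S_0(n,r)$ be the isomorphism of $\mathbb{Z}$-algebras determined by $\psi(e_{i,\underline d})=e_{i,\underline d}$, $\psi(f_{i,\underline d})=f_{i,\underline d}$ and $\psi(k_{\underline d})=k_{\underline d}$. Then the image $\psi(\mathcal{F}\times\mathcal{F}/\mathrm{GL}(V))$ of the set of $\mathrm{GL}(V)$-orbits in $\mathcal{F}\times\mathcal{F}$ is a multiplicative basis of $S_0(n,r)$.
   Context: A multiplicative basis of an algebra is a basis such that the product of any two basis elements is either zero or a basis element. Flags and orbits. Let $k$ be a field and $V$ an $r$-dimensional $k$-space; $\mathcal{F}$ is the set (variety) of $n$-step flags $f:\{0\}=V_0\subseteq\cdots\subseteq V_n=V$. $\mathrm{GL}(V)$-orbits $[f,f']$ in $\mathcal{F}\times\mathcal{F}$ (diagonal action) are in bijection with $n\times n$ matrices of non-negative integers with entries summing to $r$ via $A(f,f')_{ij}=\dim(V_{i-1}+V_i\cap V'_j)-\dim(V_{i-1}+V_i\cap V'_{j-1})$; $e_A$ is the orbit with matrix $A$. $0$-Schur algebra. There are polynomials $g_{A,A',A''}\in\mathbb{Z}[q]$ such that over every finite field $k$ and any $(f_1,f_2)\in e_{A''}$, the value of $g_{A,A',A''}$ at $|k|$ is the number of $f\in\mathcal{F}$ with $(f_1,f)\in e_A$, $(f,f_2)\in e_{A'}$. $S_q(n,r)$ is the free $\mathbb{Z}[q]$-module on the symbols $e_A$ with $e_Ae_{A'}=\sum_{A''}g_{A,A',A''}e_{A''}$,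 and $S_0(n,r)=S_q(n,r)\otimes_{\mathbb{Z}[q]}\mathbb{Z}[q]/(q)$. Generic algebra. Let $k$ be algebraically closed. Let $S(A,A')=\{(f_1,f_2): \exists f\in\mathcal{F},\ (f_1,f)\in e_A,\ (f,f_2)\in e_{A'}\}$; if non-empty it contains a unique $\mathrm{GL}(V)$-orbit open in it (Zariski topology). $G(n,r)$ is the free $\mathbb{Z}$-module with basis the set $\mathcal{F}\times\mathcal{F}/\mathrm{GL}(V)$ of orbits $e_A$, and bilinear associative product $e_A\star e_{A'}$ equal to the open orbit in $S(A,A')$ if $S(A,A')\ne\emptyset$, and $0$ otherwise. Special elements (in either algebra). For an $n$-tuple $\underline d$ of non-negative integers with sum $r$: $k_{\underline d}=e_{\mathrm{diag}(\underline d)}$; for $1\le i\le n-1$, $e_{i,\underline d}=e_A$ with $A=\mathrm{diag}(\underline d)-E_{i+1,i+1}+E_{i,i+1}$ (if $d_{i+1}>0$), and $f_{i,\underline d}=e_A$ with $A=\mathrm{diag}(\underline d)-E_{i,i}+E_{i+1,i}$ (if $d_i>0$), where $E_{a,b}$ are elementary matrices. These elements generate $G(n,r)$ as a $\mathbb{Z}$-algebra, and the isomorphism $\psi$ in the claim exists and is unique. *)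

(* Defs.v *)
From HB Require Import structures.
From mathcomp Require Import freeg mpoly.
From mathcomp Require Import all_boot all_order all_algebra.
From mathcomp Require Import boolp classical_sets.

Set Implicit Arguments.
Unset Strict Implicit.
Unset Printing Implicit Defensive.

Import GRing.Theory.
Local Open Scope ring_scope.
Local Open Scope quotient_scope.

Section Flags.
Variables (n : nat) (k : fieldType) (V : vectType k).

(* The term f i is the subspace V_i, for 0 <= i <= n; inclusions may be
   equalities. *)
Definition is_flag (f : {ffun 'I_n.+1 -> {vspace V}}) : bool :=
  [&& f ord0 == 0%VS, f ord_max == fullv
    & [forall i : 'I_n.+1, forall j : 'I_n.+1, (i <= j)%N ==> (f i <= f j)%VS]].

Record flag := Flag {
  flag_val :> {ffun 'I_n.+1 -> {vspace V}};
  _ : is_flag flag_val }.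

HB.instance Definition _ := [isSub for flag_val].
HB.instance Definition _ := [Choice of flag by <:].

(* An index i : 'I_n stands for the integer i + 1 of {1, ..., n}: the
   subspaces numbered i and i + 1 of f are the two following ones. *)
Definition flag_lo (f : flag) (i : 'I_n) : {vspace V} :=
  f (widen_ord (leqnSn n) i).
Definition flag_hi (f : flag) (i : 'I_n) : {vspace V} := f (lift ord0 i).

(* The truncated subtraction is exact, since flag_lo f' j <= flag_hi f' j. *)
Definition relmx (f f' : flag) : 'M[nat]_n :=
  \matrix_(i, j)
    (\dim (flag_lo f i + flag_hi f i :&: flag_hi f' j)
     - \dim (flag_lo f i + flag_hi f i :&: flag_lo f' j))%N.

Definition same_orbit (p q : flag * flag) : Prop :=
  exists g : 'End(V), lker g = 0%VS /\
    forall i, q.1 i = (g @: p.1 i)%VS /\ q.2 i = (g @: p.2 i)%VS.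

Definition same_orbitb : rel (flag * flag) := fun p q => `[< same_orbit p q >].

Lemma same_orbitb_refl : reflexive same_orbitb.
Proof.
move=> p; apply/asboolP; exists \1%VF; split; last by move=> i; rewrite !lim1g.
by apply/eqP/lker0P => x y; rewrite !id_lfunE.
Qed.

Lemma same_orbitb_sym : symmetric same_orbitb.
Proof.
suff imp p q : same_orbitb p q -> same_orbitb q p.
  by move=> p q; apply/idP/idP => /imp.
case/asboolP=> g [/eqP g0 gpq]; have gK := lker0_compVf g0.
apply/asboolP; exists (g^-1)%VF; split; last first.
  by move=> i; case: (gpq i) => -> ->; rewrite -!limg_comp gK !lim1g.
apply/eqP; rewrite -subv0; apply/subvP => v.
have gfull : (g @: fullv)%VS = fullv.
  by apply/eqP; rewrite eqEdim subvf /= limg_dim_eq // (eqP g0) capv0.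
have /memv_imgP[u _ ->] : v \in (g @: fullv)%VS by rewrite gfull memvf.
by rewrite memv_ker lker0_lfunK // => /eqP->; rewrite linear0 mem0v.
Qed.

Lemma same_orbitb_trans : transitive same_orbitb.
Proof.
move=> q p s /asboolP[g [/eqP/lker0P g0 gpq]] /asboolP[h [/eqP/lker0P h0 hqs]].
apply/asboolP; exists (h \o g)%VF; split.
  by apply/eqP/lker0P => x y; rewrite !comp_lfunE => /h0/g0.
move=> i; case: (gpq i) (hqs i) => p1 p2 [-> ->].
by rewrite !limg_comp p1 p2.
Qed.

Canonical same_orbit_equiv :=
  EquivRel same_orbitb same_orbitb_refl same_orbitb_sym same_orbitb_trans.
Canonical same_orbit_encModRel := defaultEncModRel same_orbitb.

Definition gl_orbit := {eq_quot same_orbitb}.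

HB.instance Definition _ := Choice.on gl_orbit.
HB.instance Definition _ := EqQuotient.on gl_orbit.

Definition orbit_of (f f' : flag) : gl_orbit := \pi_gl_orbit (f, f').

Definition orbit_mx (O : gl_orbit) : 'M[nat]_n := relmx (repr O).1 (repr O).2.

Lemma orbit_ofP (f1 f1' f2 f2' : flag) :
  orbit_of f1 f1' = orbit_of f2 f2' <-> same_orbit (f1, f1') (f2, f2').
Proof.
rewrite /orbit_of; split=> [/eqP|h]; first by rewrite eqmodE => /asboolP.
by apply/eqP; rewrite eqmodE; apply/asboolP.
Qed.

Lemma orbit_mx_of (f f' : flag) : orbit_mx (orbit_of f f') = relmx f f'.
Proof.
have : same_orbit (f, f') (repr (orbit_of f f')).
  by case e: (repr _) => [a b]; apply/orbit_ofP; rewrite /orbit_of -e reprK.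
case=> g [/eqP g0 gE]; apply/matrixP => i j.
have dimg (U : {vspace V}) : \dim (g @: U) = \dim U.
  by rewrite limg_dim_eq // (eqP g0) capv0.
rewrite !mxE /flag_lo /flag_hi !(gE _).1 !(gE _).2 /=.
by rewrite -!lker0_img_cap // -!limgD !dimg.
Qed.

(* Coordinate of w_1 /\ ... /\ w_d on the basis vector of the exterior algebra
   of V indexed by I, where (w_1, ..., w_d) is a basis of W: it is a maximal
   minor of the matrix of (w_1, ..., w_d) if #|I| = d, and 0 otherwise. Thus
   all Grassmannians of V are embedded together in the projective space of the
   exterior algebra. *)
Definition pluecker (W : {vspace V}) (I : {set 'I_(\dim (fullv : {vspace V}))}) :
    k :=
  if #|I| == \dim W then
    \det (\matrix_(a < #|I|, b < #|I|)
            coord (vbasis (fullv : {vspace V})) (enum_val b) (vbasis W)`_a)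
  else 0.

(* One factor for each term of each of the two flags. *)
Definition block := (bool * 'I_n.+1)%type.
Definition pluecker_var :=
  (block * {set 'I_(\dim (fullv : {vspace V}))})%type.

Definition flag_coords (p : flag * flag) (a : 'I_#|{: pluecker_var}|) : k :=
  let: (b, J) := enum_val a in
  pluecker ((if b.1 then p.2 else p.1) b.2) J.

Definition multihomogeneous (P : {mpoly k[#|{: pluecker_var}|]}) : Prop :=
  exists e : block -> nat, forall m, m \in msupp P -> forall b : block,
    (\sum_(a < #|{: pluecker_var}| | (enum_val a).1 == b) m a)%N = e b.

Definition zariski_closed (Z : set (flag * flag)) : Prop :=
  exists E : set {mpoly k[#|{: pluecker_var}|]},
    (forall P, E P -> multihomogeneous P) /\
    forall p, Z p <-> (forall P, E P -> P.@[flag_coords p] = 0).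

Definition zariski_open (U : set (flag * flag)) : Prop :=
  zariski_closed (~` U)%classic.

Definition composable (O O' : gl_orbit) : set (flag * flag) :=
  fun p => exists f : flag, orbit_of p.1 f = O /\ orbit_of f p.2 = O'.

(* The orbit O'' is contained in composable O O' and open in it, for the
   subspace topology. *)
Definition open_orbit (O O' : gl_orbit) : set gl_orbit := fun O'' =>
  (forall p, orbit_of p.1 p.2 = O'' -> composable O O' p) /\
  exists U, zariski_open U /\
    forall p, orbit_of p.1 p.2 = O'' <-> composable O O' p /\ U p.

Definition generic_alg := {freeg gl_orbit / int}.
HB.instance Definition _ := GRing.Zmodule.on generic_alg.

Definition generic_basis (O : gl_orbit) : generic_alg := << O >>.

(* The default value O of xget is irrelevant: over an algebraically closed
   field there is exactly one open orbit as soon as composable O O' is not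
   empty. *)
Definition generic_star (O O' : gl_orbit) : generic_alg :=
  if `[< exists p, composable O O' p >]
  then generic_basis (xget O (open_orbit O O')) else 0.

Definition generic_mul (x y : generic_alg) : generic_alg :=
  \sum_(O <- dom x) \sum_(O' <- dom y)
    generic_star O O' *~ (coeff O x * coeff O' y).

Lemma generic_mul_basis (O O' : gl_orbit) :
  generic_mul (generic_basis O) (generic_basis O') = generic_star O O'.
Proof.
by rewrite /generic_mul /generic_basis !domU1 !big_seq1 !coeffU !eqxx !mulr1.
Qed.

End Flags.

Section Schur.
Variables (n r : nat).

Record posmx := Posmx {
  posmx_val :> 'M[nat]_n;
  _ : (\sum_i \sum_j posmx_val i j == r)%N }.

HB.instance Definition _ := [isSub for posmx_val].
HB.instance Definition _ := [Choice of posmx by <:].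

(* The entries of an element of posmx are at most r, so posmx is finite. *)
Definition posmx_code (A : posmx) : 'M['I_r.+1]_n := map_mx inord A.
Definition posmx_decode (B : 'M['I_r.+1]_n) : option posmx :=
  insub (map_mx (@nat_of_ord r.+1) B).

Lemma posmx_codeK : pcancel posmx_code posmx_decode.
Proof.
move=> A; rewrite /posmx_decode /posmx_code -map_mx_comp.
suff -> : map_mx (@nat_of_ord r.+1 \o inord) A = val A by rewrite valK.
apply/matrixP => i j; rewrite !mxE /= inordK // ltnS.
case: A => A /= /eqP <-; rewrite (bigD1 i) //= (bigD1 j) //=.
by rewrite -addnA leq_addr.
Qed.

HB.instance Definition _ : isCountable posmx := PCanIsCountable posmx_codeK.
HB.instance Definition _ : isFinite posmx := PCanIsFinite posmx_codeK.

(* The polynomial P gives, over every finite field, the number of flags f with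
   (f1, f) in e_A and (f, f2) in e_A', for any (f1, f2) in e_A''. *)
Definition is_schur_poly (A A' A'' : posmx) : set {poly int} := fun P =>
  forall (K : finFieldType) (V : vectType K), \dim {:V} = r ->
  forall f1 f2 : flag n V, relmx f1 f2 = A'' ->
  exists s : seq (flag n V),
    [/\ uniq s,
        forall f, f \in s <-> relmx f1 f = A /\ relmx f f2 = A'
      & P.[#|K|%:Z] = (size s)%:Z].

(* Such polynomials exist, so the default value 0 is irrelevant; they are
   unique, because there are infinitely many values of #|K|. *)
Definition schur_poly (A A' A'' : posmx) : {poly int} :=
  xget 0 (is_schur_poly A A' A'').

(* The free R-module on the symbols e_A, with the bilinear product with
   structure constants c. It is not given the ring structure of ffun, whose
   product is pointwise. *)
Definition free_basis (R : comNzRingType) (A : posmx) : {ffun posmx -> R} :=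
  [ffun B => (A == B)%:R].

Definition free_mul (R : comNzRingType) (c : posmx -> posmx -> posmx -> R)
    (x y : {ffun posmx -> R}) : {ffun posmx -> R} :=
  [ffun A'' => \sum_A \sum_A' x A * y A' * c A A' A''].

Definition schurq := {ffun posmx -> {poly int}}.
HB.instance Definition _ := GRing.Zmodule.on schurq.
Definition schurq_mul : schurq -> schurq -> schurq := free_mul schur_poly.

(* Extension of scalars of the free Z[q]-module schurq to Z[q]/(q): the
   elements e_A (x) 1 form a basis, and the structure constants are the images
   of those of schurq. *)
Definition schur0 := {ffun posmx -> {poly %/ ('X : {poly int})}}.
HB.instance Definition _ := GRing.Zmodule.on schur0.
Definition schur0_basis : posmx -> schur0 := @free_basis _.
Definition schur0_mul : schur0 -> schur0 -> schur0 :=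
  free_mul (fun A A' A'' => in_qpoly 'X (schur_poly A A' A'')).

(* The canonical map x |-> x (x) 1; the lemmas below identify schur0 with
   schurq / q schurq. *)
Definition schur_specialize (x : schurq) : schur0 :=
  [ffun A => in_qpoly 'X (x A)].

Lemma schur_specializeD x y :
  schur_specialize (x + y) = schur_specialize x + schur_specialize y.
Proof. by apply/ffunP => A; rewrite !ffunE raddfD. Qed.

Lemma schur_specializeM x y :
  schur_specialize (schurq_mul x y) =
  schur0_mul (schur_specialize x) (schur_specialize y).
Proof.
apply/ffunP => C; rewrite !ffunE raddf_sum; apply: eq_bigr => A _.
rewrite raddf_sum; apply: eq_bigr => B _.
by rewrite !ffunE /= !in_qpolyM.
Qed.

Lemma schur_specialize_basis A :
  schur_specialize (free_basis _ A) = schur0_basis A.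
Proof. by apply/ffunP => B; rewrite !ffunE rmorph_nat. Qed.

Lemma schur_specialize_surj (z : schur0) : exists x, schur_specialize x = z.
Proof.
exists [ffun A => z A : {poly int}]; apply/ffunP => A; rewrite !ffunE.
apply/val_inj; rewrite [LHS]in_qpoly_small //; exact: size_mk_monic.
Qed.

Lemma schur_specialize_eq0 (x : schurq) :
  schur_specialize x = 0 <-> exists y : schurq, x = [ffun A => 'X * y A].
Proof.
split=> [/ffunP x0|[y ->]]; last first.
  apply/ffunP => A; rewrite !ffunE rmorphM /=.
  suff -> : in_qpoly 'X 'X = 0 :> {poly %/ ('X : {poly int})} by rewrite mul0r.
  apply/val_inj; rewrite /= mk_monic_X; exact: Pdiv.RingMonic.rmodpp (monicX _).
exists [ffun A => Pdiv.CommonRing.rdivp (x A) 'X]; apply/ffunP => A.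
move: (x0 A); rewrite !ffunE => /(congr1 val) /=; rewrite mk_monic_X => xA0.
rewrite {1}(Pdiv.RingMonic.rdivp_eq (monicX _) (x A)) xA0 addr0.
by rewrite mulrC.
Qed.

(* Indices i of {1, ..., n} are encoded by 'I_n, as above; i' is i + 1. *)
Definition is_k (d : 'rV[nat]_n) (A : posmx) : Prop :=
  map_mx Posz A = diag_mx (map_mx Posz d).

Definition is_e (i i' : 'I_n) (d : 'rV[nat]_n) (A : posmx) : Prop :=
  map_mx Posz A =
    diag_mx (map_mx Posz d) - delta_mx i' i' + delta_mx i i'.

Definition is_f (i i' : 'I_n) (d : 'rV[nat]_n) (A : posmx) : Prop :=
  map_mx Posz A =
    diag_mx (map_mx Posz d) - delta_mx i i + delta_mx i' i.

End Schur.

Definition is_Z_basis (M : zmodType) (B : set M) : Prop :=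
  (forall x, exists (s : seq M) (c : M -> int),
     (forall b, b \in s -> B b) /\ x = \sum_(b <- s) b *~ c b) /\
  (forall (s : seq M) (c : M -> int), uniq s -> (forall b, b \in s -> B b) ->
     \sum_(b <- s) b *~ c b = 0 -> forall b, b \in s -> c b = 0).

Definition is_multiplicative_basis (M : zmodType) (mul : M -> M -> M)
    (B : set M) : Prop :=
  is_Z_basis B /\
  forall b b', B b -> B b' -> mul b b' = 0 \/ B (mul b b').

(* A bijective multiplicative map sends an identity element to an identity
   element, so preservation of the unit need not be required. *)
Definition is_alg_iso (M N : zmodType) (mulM : M -> M -> M) (mulN : N -> N -> N)
    (psi : M -> N) : Prop :=
  [/\ bijective psi, {morph psi : x y / x + y}
    & {morph psi : x y / mulM x y >-> mulN x y}].

(* Main.v *)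
Require Import Defs.
From mathcomp Require Import all_boot all_order all_algebra.
From mathcomp Require Import boolp classical_sets.
From HB Require Import structures.
From mathcomp Require Import freeg.
Import GRing.Theory.
Local Open Scope ring_scope.

(** The orbits form a multiplicative basis of the generic algebra almost by
    construction: they are the basis of a free abelian group, and the product
    of two of them is an orbit or zero ([generic_basis_multiplicative]). Being
    a multiplicative basis is expressed by sums, integer multiples and products
    alone, so an isomorphism of Z-algebras carries it over to the image of the
    basis ([multiplicative_basis_image]); [psi] is such an isomorphism. *)

(** Relations between elements of the image are pulled back along the inverse
    of [psi], whose injectivity keeps the pulled-back vectors distinct. *)
Lemma Z_basis_image (M N : zmodType) (psi : M -> N) (B : set M) :
  bijective psi -> {morph psi : x y / x + y} -> is_Z_basis B ->
  is_Z_basis (psi @` B)%classic.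
Proof.
move=> [phi psiK phiK] psiD [Bspan Bfree].
have psiB : zmod_morphism psi.
  by move=> x y; apply: (addIr (psi y)); rewrite -psiD !subrK.
pose psiA : {additive M -> N} :=
  HB.pack psi (GRing.isZmodMorphism.Build M N psi psiB).
split=> [x|s c s_uniq sB s0 b bs].
  have [s [c [sB xE]]] := Bspan (phi x).
  exists (map psi s), (c \o phi); split=> [_ /mapP[b /sB Bb ->]|].
    by exists b.
  rewrite -[LHS]phiK xE -[psi]/(psiA : M -> N) raddf_sum big_map.
  by apply: eq_bigr => b _; rewrite raddfMz /= psiK.
have phiBs b' : b' \in map phi s -> B b'.
  by case/mapP=> _ /sB[b0 Bb0 <-] ->; rewrite psiK.
rewrite -[b]phiK; apply: (Bfree (map phi s) (c \o psi)) => //.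
- by rewrite map_inj_uniq //; apply: can_inj phiK.
- apply: (can_inj psiK); rewrite -[psi]/(psiA : M -> N) raddf0 -[RHS]s0.
  rewrite raddf_sum big_map; apply: eq_bigr => b' _.
  by rewrite raddfMz /= phiK.
- exact: map_f.
Qed.

Lemma multiplicative_basis_image (M N : zmodType) (mulM : M -> M -> M)
    (mulN : N -> N -> N) (psi : M -> N) (B : set M) :
  is_alg_iso mulM mulN psi -> is_multiplicative_basis mulM B ->
  is_multiplicative_basis mulN (psi @` B)%classic.
Proof.
move=> [psi_bij psiD psiM] [Bbasis BM]; split; first exact: Z_basis_image.
have psi0 : psi 0 = 0.
  by apply: (addrI (psi 0)); rewrite -psiD !addr0.
move=> _ _ [a Ba <-] [b Bb <-]; rewrite -psiM.
by have [->|Bab] := BM a b Ba Bb; [left | right; exists (mulM a b)].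
Qed.

Section GenericAlgebra.
Variables (n : nat) (k : fieldType) (V : vectType k).

Lemma generic_basis_Z_basis : is_Z_basis (range (@generic_basis n k V)).
Proof.
have coeffb (O O' : gl_orbit n V) :
    coeff O (generic_basis O') = (O' == O)%:R :> int.
  by rewrite /generic_basis coeffU mul1r.
split=> [x|s c s_uniq sB s0 b bs].
  (* The coefficient has to be a function of the basis vector rather than of
     the orbit: the orbit is recovered as the only element of the support. *)
  exists (map (@generic_basis n k V) (dom x)),
    (fun b => \sum_(O <- dom b) coeff O x); split=> [_ /mapP[O _ ->]|].
    by exists O.
  rewrite big_map -[LHS]freeg_sumE; apply: eq_bigr => O _.
  by rewrite /generic_basis domU1 big_seq1 freegU_mulz intz.
have [O _ OE] := sB b bs.
have := congr1 (coeff O) s0; rewrite coeff0 raddf_sum (bigD1_seq b) //=.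
rewrite raddfMz -{1}OE /= coeffb eqxx big_seq_cond big1 => [|b' /andP[b's b'b]].
  by rewrite addr0 intz.
have [O' _ O'E] := sB b' b's.
rewrite raddfMz -O'E /= coeffb; case: eqP => [OO'|_]; last by rewrite mul0rz.
by rewrite -OE -O'E OO' eqxx in b'b.
Qed.

Lemma generic_basis_multiplicative :
  is_multiplicative_basis (@generic_mul n k V) (range (@generic_basis n k V)).
Proof.
split; first exact: generic_basis_Z_basis.
move=> _ _ [O _ <-] [O' _ <-]; rewrite generic_mul_basis /generic_star.
by case: asboolP => _; [right; eexists | left].
Qed.

End GenericAlgebra.

Theorem corollary7p4 (n r : nat) (n_gt0 : (0 < n)%N) (r_gt0 : (0 < r)%N)
  (k : closedFieldType) (V : vectType k) (dimV : \dim {:V} = r)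
  (psi : generic_alg n V -> schur0 n r)
  (psi_iso : is_alg_iso (@generic_mul n k V) (@schur0_mul n r) psi)
  (psi_k : forall (d : 'rV[nat]_n), (\sum_i d ord0 i)%N = r ->
     forall (O : gl_orbit n V) (A : posmx n r),
       orbit_mx O = A -> is_k d A ->
       psi (generic_basis O) = schur0_basis A)
  (psi_e : forall (d : 'rV[nat]_n), (\sum_i d ord0 i)%N = r ->
     forall i i' : 'I_n, i' = i.+1 :> nat -> (0 < d ord0 i')%N ->
     forall (O : gl_orbit n V) (A : posmx n r),
       orbit_mx O = A -> is_e i i' d A ->
       psi (generic_basis O) = schur0_basis A)
  (psi_f : forall (d : 'rV[nat]_n), (\sum_i d ord0 i)%N = r ->
     forall i i' : 'I_n, i' = i.+1 :> nat -> (0 < d ord0 i)%N ->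
     forall (O : gl_orbit n V) (A : posmx n r),
       orbit_mx O = A -> is_f i i' d A ->
       psi (generic_basis O) = schur0_basis A) :
  is_multiplicative_basis (@schur0_mul n r)
    [set psi (generic_basis O) | O in [set: gl_orbit n V]]%classic.
Proof.
rewrite -(image_comp (@generic_basis n k V) psi).
apply: multiplicative_basis_image psi_iso _.
exact: generic_basis_multiplicative.
Qed.
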